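(* Let $d$ be a fixed positive integer and let $(Y_i,X_i)_{i\ge1}$ be independent and identically distributed with $Y_i\in\{0,1\}$ and $X_i\in\mathbb{R}^d$. Let $\pi_n$ be the flat prior Bayesian logistic regression posterior density, $$\pi_n(\beta)\propto\prod_{i=1}^n s(\beta^TX_i)^{Y_i}\left(1-s(\beta^TX_i)\right)^{1-Y_i},\qquad\beta\in\mathbb{R}^d,$$ and let $\beta_n^*$ be the maximum likelihood estimator (MLE), i.e. the maximizer of this likelihood. Consider the Metropolis-Hastings (MH) algorithm targeting $\pi_n$ with proposal distribution $N(\mu(\theta),hC)$, where $\mu:\mathbb{R}^d\to\mathbb{R}^d$, $h\in(0,\infty)$, and $C$ is a positive-definite, symmetric matrix; let $A(\cdot)$ be its acceptance probability. Assume the following: 1. With probability 1, for all sufficiently large $n$: the matrix $X=(X_1,\dots,X_n)^T$ is full column rank, and there exists a vector $b\in\mathbb{R}^n$ with all components positive such that ${X^*}^Tb=0$, where $X^*$ is the matrix with rows $z_iX_i^T$, $i=1,\dots,n$, with $z_i=1$ if $Y_i=0$ and $z_i=-1$ if $Y_i=1$. 2. The MLE $\beta_n^*$ is almost surely consistent to some $\beta_0\in\mathbb{R}^d$ (i.e. $\beta_n^*\to\beta_0$ almost surely). 3. $\|X_1\|_2\le1$ with probability 1. 4. For $u\in\mathbb{R}^d$, if $u\ne0$, then $X_1^Tu\ne0$ with probability 1. Then there is a $\lambda_0\in(0,\infty)$, not depending on $n$, so that, with probability 1, for all sufficiently large $n$, the MH acceptance probability satisfies $$A(\beta_n^* )\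 \le\ \left(\frac{\lambda_0}{nh}\right)^{d/2}\frac{2}{\det(C)^{1/2}}.$$
   Context: $s(x)=1/(1+e^{-x})$ is the sigmoid function. The logistic model need not be the correct data-generating mechanism. Assumption 1 ensures (by a known result) that the MLE $\beta_n^*$ exists and that $\pi_n$ is a proper density, with probability 1 for all sufficiently large $n$. With $q(\theta,\cdot)$ the Lebesgue density of $N(\mu(\theta),hC)$, the MH acceptance function is $a(\theta,\theta')=\frac{\pi_n(\theta')q(\theta',\theta)}{\pi_n(\theta)q(\theta,\theta')}\wedge1$ if $\pi_n(\theta)q(\theta,\theta')>0$ and $a(\theta,\theta')=1$ otherwise, and the acceptance probability is $A(\theta)=\int a(\theta,\theta')q(\theta,\theta')\,d\theta'$. *)

(* Defs.v *)
From HB Require Import structures.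
From mathcomp Require Import all_boot all_order all_algebra.
From mathcomp Require Import all_classical all_reals all_analysis.
Set Implicit Arguments.
Unset Strict Implicit.
Unset Printing Implicit Defensive.
Import Order.TTheory GRing.Theory Num.Theory.
Import numFieldNormedType.Exports.

Local Open Scope classical_set_scope.
Local Open Scope ring_scope.

Definition measure_matrix_display : measure_display -> measure_display.
Proof. exact. Qed.

(* Matrices carry the product sigma-algebra, i.e. the one generated by the
   coordinate maps. On 'cV[R]_d it is the Borel sigma-algebra of R^d. *)
Section measurable_matrix.
Context {d} {T : measurableType d}.
Variables m n : nat.

Definition mx_cylinder : set (set 'M[T]_(m, n)) :=
  [set A | exists i j (B : set T),
    measurable B /\ A = [set M : 'M[T]_(m, n) | B (M i j)]].

HB.instance Definition _ := @isMeasurable.Build (measure_matrix_display d)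
  'M[T]_(m, n) <<s mx_cylinder >>
  (@sigma_algebra0 _ setT mx_cylinder) (@sigma_algebraC _ mx_cylinder)
  (@sigma_algebra_bigcup _ setT mx_cylinder).

Lemma measurable_coord (i : 'I_m) (j : 'I_n) :
  measurable_fun [set: 'M[T]_(m, n)] (fun M : 'M[T]_(m, n) => M i j).
Proof.
move=> _ B mB; rewrite setTI; apply: sub_sigma_algebra.
by exists i, j, B.
Qed.

Lemma measurable_fun_mxP d' (U : measurableType d') (f : U -> 'M[T]_(m, n)) :
  measurable_fun [set: U] f <->
  forall i j, measurable_fun [set: U] (fun u => f u i j).
Proof.
split=> [mf i j|mf].
  exact: (measurableT_comp (measurable_coord i j) mf).
move=> _; apply: measurability => //.
move=> _ [_ [i [j [B [mB ->]]]] <-].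
exact: (mf i j measurableT _ mB).
Qed.

End measurable_matrix.

Section lebesgue_measure_cV.
Variable R : realType.

Local Notation RxcV n := (measurableTypeR R * 'cV[R]_n)%type.

Definition cons_cV n (p : RxcV n) : 'cV[R]_n.+1 :=
  col_mx (p.1)%:M p.2 : 'cV[R]_(1 + n).

Lemma cons_cV0 n (p : RxcV n) : cons_cV p ord0 0 = p.1.
Proof.
have := col_mxEu (p.1)%:M p.2 (0 : 'I_1) 0; rewrite [RHS]mxE eqxx mulr1n => <-.
by congr (cons_cV p _ _); exact: val_inj.
Qed.

Lemma cons_cVS n (p : RxcV n) i : cons_cV p (lift ord0 i) 0 = p.2 i 0.
Proof.
rewrite -(col_mxEd (p.1)%:M p.2 i 0).
by congr (cons_cV p _ _); exact: val_inj.
Qed.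

Lemma measurable_cons_cV n : measurable_fun [set: RxcV n] (@cons_cV n).
Proof.
apply/measurable_fun_mxP => i j; rewrite ord1.
case: (unliftP ord0 i) => [k|] ->.
  rewrite (_ : (fun _ => _) = (fun p : RxcV n => p.2 k 0)).
    exact: (measurableT_comp (measurable_coord k 0) measurable_snd).
  by apply/funext => p; rewrite cons_cVS.
rewrite (_ : (fun _ => _) = (fun p : RxcV n => p.1)).
  exact: measurable_fst.
by apply/funext => p; rewrite cons_cV0.
Qed.

Definition uncons_cV n (v : 'cV[R]_n.+1) : RxcV n :=
  (v ord0 0, \col_i v (lift ord0 i) 0).

Lemma cons_cVK n : cancel (@cons_cV n) (@uncons_cV n).
Proof.
move=> [x v]; rewrite /uncons_cV cons_cV0; congr pair.
by apply/colP => i; rewrite mxE cons_cVS.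
Qed.

Lemma measurable_uncons_cV n :
  measurable_fun [set: 'cV[R]_n.+1] (@uncons_cV n).
Proof.
apply: measurable_fun_pair; first exact: measurable_coord.
apply/measurable_fun_mxP => i j.
rewrite (_ : (fun _ => _) = (fun v : 'cV[R]_n.+1 => v (lift ord0 i) 0)).
  exact: measurable_coord.
by apply/funext => v; rewrite mxE.
Qed.

Lemma uncons_cVK n : cancel (@uncons_cV n) (@cons_cV n).
Proof.
move=> v; apply/colP => i.
by case: (unliftP ord0 i) => [k|] ->; rewrite (cons_cVS, cons_cV0)//= mxE.
Qed.


Section step.
Variables (n : nat) (m : {sigma_finite_measure set 'cV[R]_n -> \bar R}).

Definition lebesgue_cV_step : set 'cV[R]_n.+1 -> \bar R :=
  pushforward (lebesgue_measure \x m)%E (@cons_cV n).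

Let step0 : lebesgue_cV_step set0 = 0%E.
Proof. have mf := @measurable_cons_cV n; exact: measure0. Qed.

Let step_ge0 A : (0 <= lebesgue_cV_step A)%E.
Proof. have mf := @measurable_cons_cV n; exact: measure_ge0. Qed.

Let step_sigma_additive : semi_sigma_additive lebesgue_cV_step.
Proof. have mf := @measurable_cons_cV n; exact: measure_semi_sigma_additive. Qed.

HB.instance Definition _ := isMeasure.Build _ _ _ lebesgue_cV_step
  step0 step_ge0 step_sigma_additive.

Let step_sigma_finite : sigma_finite setT lebesgue_cV_step.
Proof.
have /sigma_finiteP[F [TF ndF Foo]] := sigma_finiteT (@lebesgue_measure R).
have /sigma_finiteP[G [TG ndG Goo]] := sigma_finiteT m.
exists (fun k => @uncons_cV n @^-1` (F k `*` G k)).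
  apply/esym; rewrite -subTset => v _ /=.
  have [i _ Fi] : (\bigcup_i F i) (uncons_cV v).1 by rewrite -TF.
  have [j _ Gj] : (\bigcup_j G j) (uncons_cV v).2 by rewrite -TG.
  exists (maxn i j) => //; split.
    by move: Fi; exact/subsetPset/ndF/leq_maxl.
  by move: Gj; exact/subsetPset/ndG/leq_maxr.
move=> k; have [mF Fk] := Foo k; have [mG Gk] := Goo k; split.
  rewrite -[X in measurable X]setTI; apply: measurable_uncons_cV => //.
  exact: measurableX.
rewrite /lebesgue_cV_step /pushforward -comp_preimage.
rewrite (_ : _ \o _ = id); last by apply/funext => p; exact: cons_cVK.
by rewrite preimage_id product_measure1E// lte_mul_pinfty// ge0_fin_numE.
Qed.

HB.instance Definition _ := Measure_isSigmaFinite.Build _ _ _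
  lebesgue_cV_step step_sigma_finite.

End step.

(* Lebesgue measure on R^n: the n-fold product of lebesgue_measure, transported
   along R * R^n ~ R^(n + 1); lebesgue_cV_box gives its value on boxes. *)
Fixpoint lebesgue_cV n : {sigma_finite_measure set 'cV[R]_n -> \bar R} :=
  if n is k.+1 then lebesgue_cV_step (lebesgue_cV k) else \d_(0 : 'cV[R]_0).

Lemma lebesgue_cV_box n (B : 'I_n -> set R) : (forall i, measurable (B i)) ->
  lebesgue_cV n [set v | forall i, B i (v i 0)] =
  (\prod_(i < n) lebesgue_measure (B i))%E.
Proof.
elim: n => [|n IHn] in B * => mB.
  rewrite big_ord0 /= diracE mem_set //=.
  by case.
rewrite big_ord_recl -IHn /=; last by move=> i; exact: mB.
rewrite /lebesgue_cV_step /pushforward.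
pose A := [set v : 'cV[R]_n | forall i, B (lift ord0 i) (v i 0)].
rewrite (_ : _ @^-1` _ = B ord0 `*` A).
  rewrite product_measure1E //; first exact: mB.
  rewrite (_ : A = \bigcap_(i in [set: 'I_n])
      (fun v : 'cV[R]_n => v i 0) @^-1` B (lift ord0 i)).
    apply: fin_bigcap_measurable => // i _.
    by rewrite -[X in measurable X]setTI; apply: measurable_coord.
  by apply/seteqP; split=> v Av i; [move=> _; exact: Av|exact: (Av i Logic.I)].
apply/seteqP; split=> -[x v] /=.
  move=> Bv; split; first by have := Bv ord0; rewrite cons_cV0.
  by move=> i /=; have := Bv (lift ord0 i); rewrite cons_cVS.
move=> -[Bx Av] i; case: (unliftP ord0 i) => [j|] ->.
  by rewrite cons_cVS; exact: Av.
by rewrite cons_cV0.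
Qed.

End lebesgue_measure_cV.

(* The library norm `|x| on matrices is the max norm. *)
Definition norm2 (R : realType) d (x : 'cV[R]_d) : R :=
  Num.sqrt (\sum_i x i 0 ^+ 2).

Definition symm_posdef (R : realType) d (C : 'M[R]_d) : Prop :=
  C^T = C /\ forall u : 'cV[R]_d, u != 0 -> 0 < (u^T *m C *m u) 0 0.

Section iid.
Context {d1 d2 : measure_display} {Omega : measurableType d1}
  {T : measurableType d2} {R : realType}.
Variables (P : probability Omega R) (Z : nat -> Omega -> T).

Definition mutually_independent : Prop :=
  forall (s : seq nat) (B : nat -> set T),
    uniq s -> (forall i, measurable (B i)) ->
    P (\bigcap_(i in [set` s]) (Z i @^-1` B i)) =
    (\prod_(i <- s) P (Z i @^-1` B i))%E.

Definition identically_distributed : Prop :=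
  forall (i j : nat) (B : set T), measurable B ->
    P (Z i @^-1` B) = P (Z j @^-1` B).

Definition iid : Prop := mutually_independent /\ identically_distributed.

End iid.

Definition sigmoid (R : realType) (x : R) : R := (1 + expR (- x))^-1.

(* The sample of size n consists of the pairs (Y i, X i) with i < n. *)
Section logistic_model.
Context {R : realType} {d : nat}.
Variables (n : nat) (Y : nat -> bool) (X : nat -> 'cV[R]_d).

Definition likelihood (beta : 'cV[R]_d) : R :=
  \prod_(i < n) (sigmoid ((beta^T *m X i) 0 0) ^+ (Y i) *
    (1 - sigmoid ((beta^T *m X i) 0 0)) ^+ (1 - Y i)%N).

(* [fine] makes this the zero function when the likelihood is not integrable,
   i.e. when the flat-prior posterior is improper. *)
Definition posterior (beta : 'cV[R]_d) : R :=
  likelihood beta / fine (\int[lebesgue_cV R d]_b (likelihood b)%:E).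

Definition is_MLE (beta : 'cV[R]_d) : Prop :=
  forall b : 'cV[R]_d, likelihood b <= likelihood beta.

Definition design_mx : 'M[R]_(n, d) := \matrix_(i < n, j < d) X i j 0.

Definition signed_design_mx : 'M[R]_(n, d) :=
  \matrix_(i < n, j < d) ((if Y i then -1 else 1) * X i j 0).

End logistic_model.

Definition gaussian_density (R : realType) d (m : 'cV[R]_d) (S : 'M[R]_d)
    (x : 'cV[R]_d) : R :=
  expR (- ((x - m)^T *m invmx S *m (x - m)) 0 0 / 2) /
    Num.sqrt ((2 * pi) ^+ d * \det S).

Section metropolis_hastings.
Context {R : realType} {d : nat}.
Variables (p : 'cV[R]_d -> R) (q : 'cV[R]_d -> 'cV[R]_d -> R).

Definition mh_accept (t t' : 'cV[R]_d) : R :=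
  if 0 < p t * q t t' then Num.min (p t' * q t' t / (p t * q t t')) 1 else 1.

(* For a non-negative integrand that is not measurable in t', the integral is
   the supremum of the integrals of the simple functions below it. *)
Definition mh_acceptance_probability (t : 'cV[R]_d) : \bar R :=
  \int[lebesgue_cV R d]_t' (mh_accept t t' * q t t')%:E.

End metropolis_hastings.

(* Main.v *)
Require Import Defs.
From mathcomp Require Import finmap.
From mathcomp Require Import all_boot all_order all_algebra.
From mathcomp Require Import all_classical all_reals all_analysis.
From mathcomp Require Import measurable_realfun.
From mathcomp Require Import ring lra zify.
Import Order.TTheory GRing.Theory Num.Theory.
Import numFieldNormedType.Exports.
Local Open Scope classical_set_scope.
Local Open Scope ring_scope.
Set Implicit Arguments.
Unset Strict Implicit.
Unset Printing Implicit Defensive.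

(** The acceptance probability at the maximizer [beta] of the likelihood [L] is
    small because the posterior concentrates around [beta] at scale
    [n ^ (-1/2)], while the proposal has a bounded density.  The density of
    [N (mu (theta), h C)] is at most [D = ((2 pi h)^d det C)^(-1/2)], whatever
    the mean, so the integrand [a(beta, t) q(beta, t)] is at most
    [L(t) / L(beta) * D] ([mh_accept_le]), and it remains to bound the integral
    of [L / L(beta)] by a constant times [n ^ (- d/2)], almost surely for all
    large [n].

    The decay of [L] away from [beta] is obtained globally and without
    logarithms or Hessians.  Up to a sign of the covariate, each observation
    contributes a factor [sigmoid (dotv beta (W i))], and adding [x] to the
    argument of a sigmoid multiplies it by at most the exponential of its
    tangent line divided by [1 + c * quadlin x], where [quadlin x] is
    quadratic near 0 and linear at infinity ([sigmoidD_le]).  At a maximizer the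
    tangent terms cancel ([score_le0]), so that
    [L(beta + u) <= L(beta) / \prod_i (1 + c * quadlin (dotv u (W i)))].
    The constant [c] depends only on a bound for [beta], which consistency
    provides.

    If at least half of the covariates satisfy [|dotv u (X i)| >= eps * |u|]
    for every direction [u], this product is at least
    [(1 + c * quadlin (eps * |u|)) ^ (n/2)], and by Bernoulli's inequality at
    least [\prod_j (1 + n * u_j^2) / K] ([sigmoid_productD_decay]).  The
    integral of the reciprocal is a product of [d] Cauchy integrals, namely
    [(K pi / sqrt n) ^ d] ([mh_acceptance_probability_le]).  The same bound
    shows that the posterior is proper.

    The half-spread property holds eventually because a fixed direction is
    nearly orthogonal to [X 0] only with small probability: a union bound over
    the sets of at least [n/2] indices gives the geometric bound [2 ^ (-n)] for
    the probability of failure ([iid_rarely_in]), and compactness of the unit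
    sphere makes it uniform in the direction ([eventually_half_spread]).
    Existence of the maximizer, which is what makes [betastar] a maximizer,
    follows from the positive combination of signed covariates that vanishes:
    it makes [L] coercive ([sigmoid_product_max]). *)

(** * Elementary inequalities for the logistic function *)

Section scalar_inequalities.
Context {R : realType}.
Implicit Types a c p t x y : R.

(** Quadratic near 0 and linear at infinity: within a factor 2 of
    [min (y^2) |y|], but rational, which avoids case distinctions. *)
Definition quadlin y : R := y ^+ 2 / (1 + `|y|).

Lemma quadlin_ge0 y : 0 <= quadlin y.
Proof. by rewrite divr_ge0 ?sqr_ge0// addr_ge0. Qed.

Lemma quadlinN y : quadlin (- y) = quadlin y.
Proof. by rewrite /quadlin sqrrN normrN. Qed.

Lemma ler_quadlin x y : `|x| <= `|y| -> quadlin x <= quadlin y.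
Proof.
move=> xy; have x0 := normr_ge0 x.
rewrite /quadlin -[x ^+ 2]real_normK ?num_real// -[y ^+ 2]real_normK ?num_real//.
rewrite ler_pdivrMr ?ltr_pwDl// mulrAC ler_pdivlMr ?ltr_pwDl ?(le_trans x0)//.
move: `|x| `|y| x0 xy => u v u0 uv.
rewrite !mulrDr !mulr1 lerD//; first by rewrite ler_sqr ?nnegrE// (le_trans u0).
rewrite -subr_ge0 (_ : _ - _ = u * v * (v - u)); last by ring.
by rewrite !mulr_ge0 ?subr_ge0 ?(le_trans u0).
Qed.

Lemma quadlinM_ge a x : 0 <= a <= 1 -> a ^+ 2 * quadlin x <= quadlin (a * x).
Proof.
move=> /andP[a0 a1]; rewrite /quadlin exprMn -[leRHS]mulrA.
apply: ler_wpM2l; first exact: sqr_ge0.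
apply: ler_wpM2l; first exact: sqr_ge0.
by rewrite lef_pV2 ?posrE ?ltr_pwDl// lerD2l normrM (ger0_norm a0) ler_piMl.
Qed.

(** For [y >= -2] the bound follows from [expR y = expR (y/2) ^ 2 >=
    (1 + y/2) ^ 2]; for smaller [y] its left-hand side is negative. *)
Lemma expR_ge_quadlin y : 1 + y + quadlin y / 4 <= expR y.
Proof.
have [y2|y2] := leP (-2) y.
  apply: (@le_trans _ _ ((1 + y / 2) ^+ 2)).
    rewrite (_ : (1 + y / 2) ^+ 2 = 1 + y + y ^+ 2 / 4); last by field.
    rewrite lerD2l ler_pM2r ?invr_gt0//.
    by rewrite /quadlin ler_pdivrMr ?ltr_pwDl// mulrDr mulr1 lerDl mulr_ge0 ?sqr_ge0.
  rewrite [leRHS](_ : _ = expR (y / 2) ^+ 2); last first.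
    by rewrite -expRM_natr; congr expR; field.
  by rewrite ler_sqr ?nnegrE ?expR_ge0 ?expR_ge1Dx//; lra.
apply: (@le_trans _ _ 0); last exact: expR_ge0.
rewrite /quadlin ltr0_norm; last lra.
suff : y ^+ 2 / (1 - y) <= 4 * (- y - 1) by lra.
rewrite ler_pdivrMr; last lra.
nra.
Qed.

(** Divided by [expR (- (p x))], the right-hand side is the moment generating
    function of a centred variable with values [p x] and [- (1 - p) x]: the
    linear terms of [expR_ge_quadlin] cancel and the others keep the factor
    [p (1 - p)] of its variance. *)
Lemma centered_two_point_mgf_ge p x : 0 <= p <= 1 ->
  expR (- (p * x)) * (1 + p * (1 - p) * (quadlin x / 4)) <=
  1 - p + p * expR (- x).
Proof.
move=> /andP[p0 p1]; have q0 : 0 <= 1 - p by lra.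
have -> : 1 - p + p * expR (- x) =
    expR (- (p * x)) * ((1 - p) * expR (p * x) + p * expR (- ((1 - p) * x))).
  rewrite mulrDr !mulrA ![expR _ * _]mulrC -!mulrA -!expRD addNr expR0 mulr1.
  by congr (_ + _ * expR _); ring.
rewrite ler_pM2l ?expR_gt0//.
apply: (@le_trans _ _ ((1 - p) * (1 + p * x + p ^+ 2 * quadlin x / 4) +
   p * (1 + - ((1 - p) * x) + (1 - p) ^+ 2 * quadlin x / 4))).
  by rewrite le_eqVlt; apply/orP; left; apply/eqP; field.
apply: lerD; apply: ler_wpM2l => //; apply: le_trans (expR_ge_quadlin _);
  rewrite lerD2l ler_pM2r ?invr_gt0// ?quadlinN; apply: quadlinM_ge; lra.
Qed.

(** A second-order upper bound, from [expR (- y) <= (1 + y)^-1]; it plays the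
    part of differentiating the log-likelihood at its maximum. *)
Lemma two_point_mgf_le p y : 0 <= p <= 1 -> - (1 / 2) <= y ->
  1 - p + p * expR (- y) <= expR (- (p * y) + 2 * y ^+ 2).
Proof.
move=> /andP[p0 p1] y2.
have eyV : expR (- y) <= (1 + y)^-1.
  by rewrite expRN lef_pV2 ?posrE ?expR_gt0 ?expR_ge1Dx//; lra.
have yV : (1 + y)^-1 <= 1 - y + 2 * y ^+ 2.
  rewrite -div1r ler_pdivrMr; last lra.
  nra.
apply: le_trans (expR_ge1Dx _); nra.
Qed.

Lemma sigmoid_gt0 t : 0 < sigmoid t.
Proof. by rewrite /sigmoid invr_gt0 addr_gt0 ?expR_gt0. Qed.

Lemma sigmoid_le1 t : sigmoid t <= 1.
Proof. by rewrite /sigmoid invf_le1 ?addr_gt0 ?expR_gt0// lerDl expR_ge0. Qed.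

Lemma sigmoidN t : sigmoid (- t) = 1 - sigmoid t.
Proof.
rewrite /sigmoid opprK expRN; have := expR_gt0 t => e0.
by field; rewrite !lt0r_neq0// addr_gt0.
Qed.

Lemma ler_sigmoid s t : s <= t -> sigmoid s <= sigmoid t.
Proof.
move=> st; rewrite /sigmoid lef_pV2 ?posrE ?addr_gt0 ?expR_gt0//.
by rewrite lerD2l ler_expR lerN2.
Qed.

Lemma sigmoidD t x :
  sigmoid (t + x) = sigmoid t / (1 - sigmoid (- t) + sigmoid (- t) * expR (- x)).
Proof.
rewrite -sigmoidN opprK sigmoidN /sigmoid opprD expRD.
have := expR_gt0 (- t); have := expR_gt0 (- x).
move: (expR (- t)) (expR (- x)) => u v v0 u0.
have /lt0r_neq0 n1 : 0 < 1 + u by rewrite addr_gt0.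
have /lt0r_neq0 n2 : 0 < 1 + u * v by rewrite addr_gt0// mulr_gt0.
have /lt0r_neq0 n3 : 0 < 1 + (1 + u - 1) * v.
  by rewrite addr_gt0// mulr_gt0//; lra.
by field; rewrite ?n1 ?n2 ?n3.
Qed.

(** Quantitative concavity of [ln \o sigmoid], whose derivative at [t] is
    [sigmoid (- t)]: the exponential is the tangent line, the denominator the
    gap below it. *)
Lemma sigmoidD_le t x :
  sigmoid (t + x) <= sigmoid t * expR (sigmoid (- t) * x) /
    (1 + sigmoid (- t) * (1 - sigmoid (- t)) * (quadlin x / 4)).
Proof.
set p := sigmoid (- t).
have p0 : 0 < p := sigmoid_gt0 _; have p1 : p <= 1 := sigmoid_le1 _.
have k0 : 0 <= p * (1 - p) * (quadlin x / 4).
  apply: mulr_ge0; last by rewrite divr_ge0 ?quadlin_ge0.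
  by apply: mulr_ge0; lra.
rewrite sigmoidD -/p -mulrA ler_wpM2l ?(ltW (sigmoid_gt0 _))//.
have p01 : 0 <= p <= 1 by rewrite p1 ltW.
have := centered_two_point_mgf_ge x p01; rewrite expRN => mgf.
rewrite -[X in _ <= X]invrK lef_pV2 ?posrE; last 2 first.
- apply: lt_le_trans mgf.
  by rewrite mulr_gt0 ?invr_gt0 ?expR_gt0// ltr_pwDl.
- by rewrite invr_gt0 mulr_gt0 ?invr_gt0 ?expR_gt0// ltr_pwDl.
by rewrite invfM invrK.
Qed.

(** In the rescaled variable [s = sqrt N * y], [N * quadlin (eps * y)] is at
    least [eps^2 * s^2 / (1 + s)], which is linear in [s] at infinity; the square
    makes the reciprocal integrable. *)
Lemma quadlin_scaled_ge (eps c N y : R) :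
  0 <= eps <= 1 -> 0 <= c -> c * eps ^+ 2 <= 1 -> 1 <= N -> 0 <= y ->
  (c * eps ^+ 2) ^+ 2 / 2 * (1 + N * y ^+ 2) <=
  (1 + c * (N * quadlin (eps * y))) ^+ 2.
Proof.
move=> /andP[e0 e1] c0 a1 N1 y0.
have N0 : 0 <= N by rewrite (le_trans _ N1).
pose s := Num.sqrt N * y.
have s2 : s ^+ 2 = N * y ^+ 2 by rewrite exprMn sqr_sqrtr.
have sN1 : 1 <= Num.sqrt N by rewrite -[leLHS]sqrtr1 ler_wsqrtr.
have ys : y <= s by rewrite /s ler_peMl.
have s0 : 0 <= s by rewrite (le_trans y0).
have a0 : 0 <= c * eps ^+ 2 by rewrite mulr_ge0 ?sqr_ge0.
have lb : c * eps ^+ 2 * (s ^+ 2 / (1 + s)) <= c * (N * quadlin (eps * y)).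
  rewrite -mulrA ler_wpM2l// s2 /quadlin exprMn.
  rewrite (_ : N * (_ / _) = eps ^+ 2 * (N * y ^+ 2 / (1 + `|eps * y|))); last by ring.
  rewrite ler_wpM2l ?sqr_ge0// ler_wpM2l ?mulr_ge0 ?sqr_ge0//.
  rewrite lef_pV2 ?posrE ?ltr_pwDl// lerD2l ger0_norm ?mulr_ge0//.
  by rewrite (le_trans _ ys)// ler_piMl.
apply: (@le_trans _ _ ((c * eps ^+ 2 * (1 + s ^+ 2 / (1 + s))) ^+ 2)).
  rewrite [leRHS]exprMn -[leLHS]mulrA -s2; apply: ler_wpM2l; first exact: sqr_ge0.
  have s1 : 0 < 1 + s by lra.
  rewrite (_ : 1 + s ^+ 2 / (1 + s) = (1 + s + s ^+ 2) / (1 + s)); last first.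
    by field; lra.
  rewrite expr_div_n ler_pdivlMr ?exprn_gt0//.
  have s20 : 0 <= s ^+ 2 by rewrite sqr_ge0.
  apply: (@le_trans _ _ ((1 + s ^+ 2) ^+ 2)).
    rewrite [leRHS]expr2 mulrAC; apply: ler_wpM2r; first lra.
    have := sqr_ge0 (1 - s); lra.
  by rewrite ler_sqr ?nnegrE//; lra.
rewrite ler_sqr ?nnegrE; first by rewrite mulrDr mulr1 lerD.
  by rewrite mulr_ge0 ?addr_ge0 ?divr_ge0 ?sqr_ge0// addr_ge0.
by rewrite addr_ge0 ?mulr_ge0 ?quadlin_ge0.
Qed.

Lemma bernoulli_ge (x : R) (n : nat) : 0 <= x -> 1 + n%:R * x <= (1 + x) ^+ n.
Proof.
move=> x0; elim: n => [|n IH]; first by rewrite mul0r addr0 expr0.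
rewrite exprS (le_trans _ (ler_wpM2l _ IH)) ?addr_ge0//.
rewrite -natr1; have : 0 <= n%:R * x * x by rewrite !mulr_ge0.
by move: n%:R => m mx; lra.
Qed.

(** Bernoulli's inequality applied to [2 d] blocks of [n / (4 d)] factors
    each, which fit into the [m >= n / 2] factors available; two blocks will
    serve each of the [d] coordinates. *)
Lemma pow_half_count_ge (x : R) (d n m : nat) : 0 <= x ->
  (0 < d)%N -> (4 * d <= n)%N -> (n <= 2 * m)%N ->
  (1 + n%:R / (8 * d%:R) * x) ^+ (2 * d) <= (1 + x) ^+ m.
Proof.
move=> x0 d0 dn nm.
pose q := (n %/ (4 * d))%N.
have q1 : (0 < q)%N by rewrite divn_gt0 ?muln_gt0.
have qm : (q * (2 * d) <= m)%N.
  rewrite -(leq_pmul2l (isT : (0 < 2)%N)) (leq_trans _ nm)//.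
  by rewrite mulnCA mulnA -mulnA [(2 * (2 * d))%N]mulnA leq_trunc_div.
have dR : 0 < d%:R :> R by rewrite ltr0n.
have nq : n%:R / (8 * d%:R) <= q%:R :> R.
  rewrite ler_pdivrMr ?mulr_gt0// -!natrM ler_nat.
  have : (n < q.+1 * (4 * d))%N by rewrite ltn_ceil ?muln_gt0.
  by move/ltnW/leq_trans; apply; rewrite mulnA; nia.
apply: (@le_trans _ _ ((1 + q%:R * x) ^+ (2 * d))).
  have h0 : 0 <= n%:R / (8 * d%:R) * x.
    by rewrite mulr_ge0// divr_ge0// mulr_ge0.
  rewrite lerXn2r ?nnegrE ?addr_ge0 ?mulr_ge0//.
  by rewrite lerD2l ler_wpM2r.
apply: (@le_trans _ _ (((1 + x) ^+ q) ^+ (2 * d))).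
  by rewrite lerXn2r ?nnegrE ?bernoulli_ge ?exprn_ge0 ?addr_ge0 ?mulr_ge0.
by rewrite -exprM ler_weXn2l// lerDl.
Qed.

End scalar_inequalities.

(** * Scalar products and the sup norm *)

Section vectors.
Context {R : realType} {d : nat}.
Implicit Types u v b : 'cV[R]_d.

Definition dotv u v : R := (u^T *m v) 0 0.

Lemma dotvE u v : dotv u v = \sum_i u i 0 * v i 0.
Proof. by rewrite /dotv mxE; apply: eq_bigr => i _; rewrite mxE. Qed.

Lemma dotvC u v : dotv u v = dotv v u.
Proof. by rewrite !dotvE; apply: eq_bigr => i _; rewrite mulrC. Qed.

Lemma dotvDl u v w : dotv (u + v) w = dotv u w + dotv v w.
Proof. by rewrite /dotv linearD mulmxDl mxE. Qed.

Lemma dotvZl a u w : dotv (a *: u) w = a * dotv u w.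
Proof. by rewrite /dotv linearZ -scalemxAl mxE. Qed.

Lemma dotvNr u w : dotv u (- w) = - dotv u w.
Proof. by rewrite /dotv mulmxN mxE. Qed.

Lemma coord_le_norm u i : `|u i 0| <= `|u|.
Proof.
rewrite [leRHS]/Num.norm /= mx_normrE.
by apply/bigmax_geP; right => /=; exists (i, 0).
Qed.

Lemma norm_le_coord u (M : R) :
  0 <= M -> (forall i, `|u i 0| <= M) -> `|u| <= M.
Proof.
move=> M0 uM; rewrite [leLHS]/Num.norm /= mx_normrE.
by apply/bigmax_leP; split => // -[i j] _ /=; rewrite ord1.
Qed.

Lemma dotv_le u v : `|dotv u v| <= d%:R * `|u| * `|v|.
Proof.
rewrite dotvE (le_trans (ler_norm_sum _ _ _))//.
apply: (@le_trans _ _ (\sum_(i < d) `|u| * `|v|)).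
  by apply: ler_sum => i _; rewrite normrM ler_pM ?coord_le_norm.
by rewrite sumr_const card_ord -mulrA mulr_natl.
Qed.

End vectors.

(** * Decay of the likelihood away from its maximizer *)

Section likelihood.
Context {R : realType} {d : nat}.
Implicit Types (u b beta : 'cV[R]_d).

(** Since [1 - sigmoid t = sigmoid (- t)], a response 0 amounts to a response 1
    with the opposite covariate. *)
Definition signed_cov (y : bool) (x : 'cV[R]_d) := if y then x else - x.

Lemma norm_dotv_signed_cov u y x : `|dotv u (signed_cov y x)| = `|dotv u x|.
Proof. by case: y => //=; rewrite dotvNr normrN. Qed.

Definition sigmoid_product (n : nat) (W : nat -> 'cV[R]_d) b : R :=
  \prod_(i < n) sigmoid (dotv b (W i)).

Lemma likelihoodE n (Y : nat -> bool) (X : nat -> 'cV[R]_d) :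
  likelihood n Y X = sigmoid_product n (fun i => signed_cov (Y i) (X i)).
Proof.
apply/funext => b; apply: eq_bigr => i _; rewrite -/(dotv _ _).
case: (Y i) => /=; first by rewrite expr1 expr0 mulr1.
by rewrite expr0 mul1r expr1 dotvNr sigmoidN.
Qed.

Variables (n : nat) (W : nat -> 'cV[R]_d).
Local Notation L := (sigmoid_product n W).

Lemma sigmoid_product_gt0 b : 0 < L b.
Proof. by apply: prodr_gt0 => i _; exact: sigmoid_gt0. Qed.

(** The sum is the derivative of [ln L] at the maximizer in the direction [u].
    Were it positive, a small step along [u] would increase [L]. *)
Lemma score_le0 beta u : (forall b, L b <= L beta) ->
  \sum_(i < n) sigmoid (- dotv beta (W i)) * dotv u (W i) <= 0.
Proof.
move=> maxL; set S := \sum_(_ < _) _; rewrite leNgt; apply/negP => S0.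
pose Q := \sum_(i < n) dotv u (W i) ^+ 2.
have Q0 : 0 <= Q by apply: sumr_ge0 => i _; exact: sqr_ge0.
(* [s] is small enough for every [s * dotv u (W i)] to be in the range of
   [two_point_mgf_le] and for the error [2 s^2 Q] to be less than [s S] *)
pose s := S / (2 * (1 + Q) * (1 + S)).
have s0 : 0 < s by rewrite divr_gt0// !mulr_gt0//; lra.
have sQ : s * (1 + Q) <= 1 / 2.
  rewrite /s (_ : _ * _ = S / (1 + S) / 2); last by field; lra.
  by rewrite ler_pM2r ?invr_gt0// ler_pdivrMr; lra.
have sQS : 2 * s * Q < S.
  rewrite /s (_ : _ * _ = S * (Q / (1 + Q) / (1 + S))); last by field; lra.
  rewrite gtr_pMr// ltr_pdivrMr; last lra.
  by rewrite ltr_pdivrMr; last lra; nra.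
have xQ (i : 'I_n) : dotv u (W i) ^+ 2 <= Q.
  by rewrite /Q (bigD1 i)//= lerDl sumr_ge0// => j _; exact: sqr_ge0.
pose e (i : 'I_n) :=
  - (sigmoid (- dotv beta (W i)) * (s * dotv u (W i))) +
  2 * (s * dotv u (W i)) ^+ 2.
have eE : \sum_i e i = - (s * S) + 2 * s ^+ 2 * Q.
  rewrite big_split/= sumrN /S /Q !mulr_sumr; congr (- _ + _);
  by apply: eq_bigr => i _; ring.
have Lstep : L beta * expR (- \sum_i e i) <= L (beta + s *: u).
  rewrite -sumrN expR_sum -big_split/=; apply: ler_prod => i _.
  rewrite mulr_ge0 ?expR_ge0 ?(ltW (sigmoid_gt0 _))//= dotvDl dotvZl sigmoidD.
  rewrite ler_pM2l ?sigmoid_gt0// [X in X <= _]expRN lef_pV2 ?posrE ?expR_gt0//.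
    apply: two_point_mgf_le.
      by rewrite (ltW (sigmoid_gt0 _)) sigmoid_le1.
    have := xQ i; move: (dotv _ _) => x xQi.
    have : `|s * x| <= 1 / 2.
      rewrite normrM (gtr0_norm s0) (le_trans _ sQ)// ler_pM2l//.
      rewrite -[ `|x|]mul1r; have := sqr_ge0 (1 - `|x|).
      rewrite -[x ^+ 2]real_normK ?num_real// in xQi; nra.
    by rewrite ler_norml => /andP[].
  by rewrite ltr_wpDl ?subr_ge0 ?sigmoid_le1// mulr_gt0 ?sigmoid_gt0 ?expR_gt0.
have := le_trans Lstep (maxL _).
rewrite -[leRHS]mulr1 ler_pM2l ?sigmoid_product_gt0// expR_le1 eE.
by nra.
Qed.

(** The tangent terms of [sigmoidD_le] multiply to the exponential of the
    score, which is at most 1 at a maximizer. *)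
Lemma sigmoid_productD_le beta u (kappa : R) : (forall b, L b <= L beta) ->
  0 <= kappa ->
  (forall i : 'I_n, kappa <= sigmoid (- dotv beta (W i)) * sigmoid (dotv beta (W i))) ->
  L (beta + u) <= L beta / \prod_(i < n) (1 + kappa / 4 * quadlin (dotv u (W i))).
Proof.
move=> maxL k0 hk.
have den0 (i : 'I_n) : 0 < 1 + kappa / 4 * quadlin (dotv u (W i)).
  by rewrite ltr_pwDl// mulr_ge0 ?quadlin_ge0// divr_ge0.
apply: (@le_trans _ _ (\prod_(i < n) (sigmoid (dotv beta (W i)) *
    expR (sigmoid (- dotv beta (W i)) * dotv u (W i)) /
    (1 + kappa / 4 * quadlin (dotv u (W i)))))).
  apply: ler_prod => i _; rewrite (ltW (sigmoid_gt0 _))/= dotvDl.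
  apply: le_trans (sigmoidD_le _ _) _.
  rewrite ler_wpM2l ?mulr_ge0 ?expR_ge0 ?(ltW (sigmoid_gt0 _))//.
  rewrite lef_pV2 ?posrE//.
    rewrite lerD2l -[_ / 4 * _]mulrA [4^-1 * _]mulrC -sigmoidN opprK.
    by apply: ler_wpM2r; [rewrite divr_ge0 ?quadlin_ge0|exact: hk].
  rewrite ltr_pwDl//; apply: mulr_ge0; last by rewrite (divr_ge0 (quadlin_ge0 _)).
  by rewrite -sigmoidN mulr_ge0 ?(ltW (sigmoid_gt0 _)).
rewrite !big_split/= -expR_sum [X in _ * X <= _]prodfV -mulrA.
apply: ler_wpM2l; first exact: ltW (sigmoid_product_gt0 _).
rewrite ler_piMl//.
  by rewrite invr_ge0 prodr_ge0// => i _; exact: ltW.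
by rewrite expR_le1 score_le0.
Qed.

(** The sup norm of [u] dominates each [`|u j 0|], so that the power [2 d] of a
    function of [`|u|] splits into one square for each coordinate.  The bound is
    a product of functions of one coordinate, which is what makes it integrable
    by iteration.  In the constant, 32 d is the product of the 4 of
    [sigmoid_productD_le] and the 8 d of [pow_half_count_ge]. *)
Lemma sigmoid_productD_decay beta u (kappa eps : R) : (0 < d)%N -> (4 * d <= n)%N ->
  (forall b, L b <= L beta) -> 0 < kappa <= 1 -> 0 < eps <= 1 ->
  (forall i : 'I_n, kappa <= sigmoid (- dotv beta (W i)) * sigmoid (dotv beta (W i))) ->
  (n <= 2 * #|[pred i : 'I_n | (eps * `|u| <= `|dotv u (W i)|)%R]|)%N ->
  L (beta + u) <= L beta * \prod_(j < d)
    (2 / (kappa * eps ^+ 2 / (32 * d%:R)) ^+ 2 / (1 + n%:R * u j 0 ^+ 2)).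
Proof.
move=> d0 dn maxL /andP[kp k1] /andP[e0 e1] hk hm.
set a := kappa * eps ^+ 2 / (32 * d%:R).
have k0 := ltW kp.
have n1 : 1 <= n%:R :> R by rewrite ler1n; lia.
have dR : 1 <= d%:R :> R by rewrite ler1n.
pose g (x : R) := 1 + kappa / (32 * d%:R) * (n%:R * quadlin (eps * x)).
have c0 : 0 <= kappa / (32 * d%:R) by rewrite divr_ge0// mulr_ge0.
have g0 x : 0 < g x.
  by rewrite ltr_pwDl// mulr_ge0// mulr_ge0 ?quadlin_ge0.
have k4 : 0 <= kappa / 4 by rewrite divr_ge0.
have aE : a = kappa / (32 * d%:R) * eps ^+ 2 by rewrite /a mulrAC.
have a1 : a <= 1.
  rewrite aE; apply: mulr_ile1 => //; first exact: sqr_ge0.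
    by rewrite ler_pdivrMr ?mulr_gt0//; lra.
  by rewrite expr_le1// ltW.
apply: le_trans (sigmoid_productD_le u maxL k0 hk) _.
rewrite ler_pM2l ?sigmoid_product_gt0//.
pose m := #|[pred i : 'I_n | eps * `|u| <= `|dotv u (W i)|]|.
apply: (@le_trans _ _ ((1 + kappa / 4 * quadlin (eps * `|u|)) ^+ m)^-1).
  have q0 : 0 < 1 + kappa / 4 * quadlin (eps * `|u|).
    by rewrite ltr_pwDl// mulr_ge0 ?quadlin_ge0.
  rewrite lef_pV2 ?posrE ?exprn_gt0//; last first.
    apply: prodr_gt0 => i _.
    by rewrite ltr_pwDl// mulr_ge0 ?quadlin_ge0.
  rewrite (bigID [pred i : 'I_n | eps * `|u| <= `|dotv u (W i)|])/=.
  rewrite -[leLHS]mulr1; apply: ler_pM => //; first by rewrite exprn_ge0// ltW.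
    rewrite -prodr_const; apply: ler_prod => i hi; rewrite ltW//=.
    rewrite lerD2l ler_wpM2l ?divr_ge0//; apply: ler_quadlin.
    by rewrite ger0_norm// mulr_ge0// ltW.
  apply: (big_ind (fun x => 1 <= x)) => // [x y|i _]; first exact: mulr_ege1.
  by rewrite lerDl mulr_ge0 ?quadlin_ge0.
apply: (@le_trans _ _ (g `|u| ^+ (2 * d))^-1).
  rewrite lef_pV2 ?posrE ?exprn_gt0//; last first.
    by rewrite ltr_pwDl// mulr_ge0 ?quadlin_ge0.
  have -> : g `|u| = 1 + n%:R / (8 * d%:R) * (kappa / 4 * quadlin (eps * `|u|)).
    by rewrite /g; field; lra.
  by apply: pow_half_count_ge => //; rewrite mulr_ge0 ?quadlin_ge0.
rewrite exprM -[X in _ ^+ X]card_ord -prodr_const -prodfV; apply: ler_prod => j _.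
have ap : 0 < a by rewrite divr_gt0 ?mulr_gt0 ?exprn_gt0//; lra.
have n0 : 0 < 1 + n%:R * u j 0 ^+ 2 by rewrite ltr_pwDl// mulr_ge0 ?sqr_ge0.
rewrite invr_ge0 sqr_ge0/= -invf_div lef_pV2 ?posrE ?exprn_gt0//; last first.
  by rewrite divr_gt0// divr_gt0// exprn_gt0.
apply: (@le_trans _ _ (g `|u j 0| ^+ 2)); last first.
  rewrite ler_sqr ?nnegrE ?(ltW (g0 _))// /g lerD2l ler_wpM2l// ler_wpM2l//.
  apply: ler_quadlin; rewrite !normrM ler_wpM2l//.
  by rewrite !normr_id coord_le_norm.
rewrite [X in X <= _](_ : _ = a ^+ 2 / 2 * (1 + n%:R * u j 0 ^+ 2)); last first.
  by field; rewrite lt0r_neq0.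
rewrite aE -[u j 0 ^+ 2]real_normK ?num_real//.
by apply: quadlin_scaled_ge => //; rewrite -?aE// ltW.
Qed.

End likelihood.

(** * Existence of the maximum likelihood estimator *)

Section topology_cV.
Context {R : realType} {d : nat}.

(** Transposition carries a box of row vectors, which is compact, to a box of
    column vectors. *)
Lemma compact_cV (A : set 'cV[R]_d) (M : R) :
  closed A -> (forall u, A u -> `|u| <= M) -> compact A.
Proof.
move=> cA AM.
pose box := [set v : 'rV[R]_d | forall i, `[- M, M]%classic (v ord0 i)].
have cbox : compact box.
  apply: (@rV_compact _ _ (fun=> `[- M, M]%classic)) => i.
  exact: segment_compact.
have trc : continuous (fun v : 'rV[R]_d => v^T : 'cV[R]_d).
  move=> v; apply/(@cvgrPdist_lt _ _ _ _ (nbhs_filter v)) => e e0.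
  apply/(@nbhs_normP R 'rV[R]_d); exists e => //= w vw.
  apply: le_lt_trans vw; rewrite -linearB; apply: norm_le_coord => // i.
  rewrite mxE [leRHS]/Num.norm /= mx_normrE.
  by apply/bigmax_geP; right => /=; exists (0, i).
have := continuous_compact (continuous_subspaceT trc) cbox.
move/(subclosed_compact cA); apply => u Au.
exists u^T; last by rewrite trmxK.
move=> i /=; rewrite in_itv/= -ler_norml mxE.
exact: le_trans (coord_le_norm _ _) (AM _ Au).
Qed.

Lemma continuous_dotv (w : 'cV[R]_d) : continuous (fun u => dotv u w).
Proof.
rewrite (_ : dotv^~ w = fun u => \sum_i u i 0 * w i 0); last first.
  by apply/funext => u; rewrite dotvE.
apply: continuous_big => [|i _ u]; first exact: add_continuous.
exact: (@continuousM _ _ (fun u : 'cV[R]_d => u i 0) (cst (w i 0)) u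
  (@coord_continuous R d 1 i 0 u) (@cst_continuous _ _ _ u)).
Qed.

Lemma continuous_sigmoid : continuous (@sigmoid R).
Proof.
move=> x; apply: cvgV; first by rewrite gt_eqF// addr_gt0// expR_gt0.
apply: cvgD; first exact: cvg_cst.
apply: continuous_comp; last exact: continuous_expR.
exact: opp_continuous.
Qed.

Lemma continuous_sigmoid_product n (W : nat -> 'cV[R]_d) :
  continuous (sigmoid_product n W).
Proof.
apply: continuous_big => [|i _ b]; first exact: mul_continuous.
exact: (@continuous_comp _ _ _ (fun b => dotv b (W i)) (@sigmoid R) b
  (@continuous_dotv _ b) (@continuous_sigmoid _)).
Qed.

(** Where [L u >= L 0], each factor is at least [L 0], so that no
    [dotv u (W i)] is very negative.  Their combination with the positive weights
    [b] vanishes, so that none is very large either, and a left inverse of the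
    design matrix then bounds [u].  Hence the maximum over a large ball is
    global. *)
Lemma sigmoid_product_max (n : nat) (Y : nat -> bool) (X : nat -> 'cV[R]_d)
    (b : 'cV[R]_n) :
  \rank (design_mx n X) = d -> (forall i, 0 < b i 0) ->
  (signed_design_mx n Y X)^T *m b = 0 ->
  exists beta, is_MLE n Y X beta.
Proof.
move=> rkX b0 Xb; set W := fun i => signed_cov (Y i) (X i).
have balanced u : \sum_(i < n) b i 0 * dotv u (W i) = 0.
  have /(congr1 (fun v => - dotv u v)) := Xb.
  rewrite {2}/dotv mulmx0 mxE oppr0 => h; rewrite -[RHS]h.
  rewrite dotvE -sumrN.
  rewrite (eq_bigr (fun i : 'I_n => \sum_j u j 0 * (b i 0 * W i j 0))); last first.
    by move=> i _; rewrite dotvE mulr_sumr; apply: eq_bigr => j _; rewrite mulrCA.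
  rewrite exchange_big; apply: eq_bigr => j _.
  rewrite -mulr_sumr -mulrN; congr (_ * _).
  rewrite mxE -sumrN; apply: eq_bigr => i _; rewrite !mxE /W /signed_cov.
  by case: (Y i); rewrite ?mxE; ring.
have [B BX] : exists B, B *m design_mx n X = 1%:M.
  by apply/row_fullP; rewrite /row_full rkX.
pose L := sigmoid_product n W.
pose T := (L 0)^-1.
have T0 : 0 < T by rewrite invr_gt0 sigmoid_product_gt0.
have dot_ge u (i : 'I_n) : L 0 <= L u -> - T <= dotv u (W i).
  move=> Lu.
  (* the other factors are at most 1 *)
  have sLi : L 0 <= sigmoid (dotv u (W i)).
    apply: le_trans Lu _; rewrite /L /sigmoid_product (bigD1 i)//=.
    rewrite ler_piMr ?(ltW (sigmoid_gt0 _))//.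
    by apply: prodr_ile1 => j _; rewrite (ltW (sigmoid_gt0 _)) sigmoid_le1.
  rewrite lerNl /T; have := expR_ge1Dx (- dotv u (W i)).
  move: sLi; rewrite /sigmoid.
  rewrite -[X in X <= _]invrK lef_pV2 ?posrE ?invr_gt0 ?sigmoid_product_gt0
    ?addr_gt0 ?expR_gt0//.
  lra.
pose M i := T * (\sum_(k < n) b k 0) / b i 0.
have sumb0 : 0 <= \sum_(k < n) b k 0 by apply: sumr_ge0 => k _; exact: ltW.
have M0 i : 0 <= M i by apply: divr_ge0; [apply: mulr_ge0 => //|]; exact: ltW.
have dot_le u (i : 'I_n) : L 0 <= L u -> `|dotv u (W i)| <= Num.max T (M i).
  move=> Lu; rewrite ler_norml; apply/andP; split.
    by rewrite (le_trans _ (dot_ge _ i Lu))// lerN2 le_max lexx.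
  rewrite le_max; apply/orP; right; rewrite ler_pdivlMr//.
  have := balanced u; rewrite (bigD1 i)//= => /eqP; rewrite addr_eq0 => /eqP.
  rewrite mulrC => ->; rewrite -sumrN mulr_sumr [leRHS](bigD1 i)//=.
  rewrite ler_wpDl ?mulr_ge0 ?(ltW T0) ?(ltW (b0 _))//.
  apply: ler_sum => k _; rewrite -mulrN mulrC ler_pM2r//.
  by rewrite lerNl dot_ge.
pose K := \sum_j \sum_i `|B j i| * Num.max T (M i).
have maxTM0 i : 0 <= Num.max T (M i) by rewrite le_max (ltW T0).
have K0 : 0 <= K by apply: sumr_ge0 => j _; apply: sumr_ge0 => i _; exact: mulr_ge0.
have bounded u : L 0 <= L u -> `|u| <= K.
  move=> Lu; apply: norm_le_coord => // j.
  have -> : u j 0 = \sum_i B j i * dotv u (X i).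
    rewrite -[in LHS](mul1mx u) -BX -mulmxA mxE; apply: eq_bigr => i _.
    by rewrite dotvC dotvE mxE; congr (_ * _); apply: eq_bigr => k _; rewrite mxE.
  apply: le_trans (ler_norm_sum _ _ _) _.
  rewrite /K (bigD1 j)//=; apply: ler_wpDr.
    by apply: sumr_ge0 => k _; apply: sumr_ge0 => i _; exact: mulr_ge0.
  apply: ler_sum => i _; rewrite normrM ler_wpM2l//.
  by rewrite -(norm_dotv_signed_cov _ (Y i)) dot_le.
have cball : compact [set u : 'cV[R]_d | `|u| <= K].
  apply: (@compact_cV _ K) => //.
  exact: ((continuous_closedP (fun u : 'cV[R]_d => `|u|)).1
    (@norm_continuous R 'cV[R]_d) _ (@closed_le _ K)).
have [|beta bK bmax] := compact_EVT_max _ cball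
    (continuous_subspaceT (@continuous_sigmoid_product n W)).
  by exists 0; rewrite /= normr0.
exists beta; rewrite /is_MLE likelihoodE => u.
have [uK|Ku] := leP `|u| K; first by apply: bmax; rewrite inE.
apply: (@le_trans _ _ (L 0)).
  by rewrite leNgt; apply/negP => /ltW/bounded; rewrite leNgt Ku.
by apply: bmax; rewrite inE /= normr0.
Qed.

End topology_cV.

(** * Integration over column vectors *)

Section integrals.
Context {R : realType}.
Local Notation mu := (@lebesgue_measure R).

Lemma integralT_oneDsqrV : (\int[mu]_x (oneDsqr x)^-1%:E = pi%:E)%E.
Proof.
rewrite (@ge0_symfun_integralT _ (fun x => (oneDsqr x)^-1)).
- rewrite (_ : [set x | _] = `[0, +oo[%classic); last first.
    by apply/seteqP; split => x/=; rewrite in_itv/= andbT.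
  by rewrite integral0y_oneDsqr -EFinM mulrCA divff// mulr1.
- by move=> x; rewrite invr_ge0.
- exact: continuous_oneDsqrV.
- by move=> x; rewrite /oneDsqr /= sqrrN.
Qed.

Lemma continuous_cauchy (a b : R) : 0 < a ->
  continuous (fun x : R => (1 + a * (x - b) ^+ 2)^-1).
Proof.
move=> a0 x; apply: cvgV.
  by rewrite gt_eqF// ltr_pwDl// mulr_ge0 ?sqr_ge0// ltW.
have : derivable (fun x : R => 1 + a * (x - b) ^+ 2) x (1 : R) by exact: ex_derive.
by move=> /derivable1_diffP/differentiable_continuous.
Qed.

Lemma integralT_cauchy (a b : R) : 0 < a ->
  (\int[mu]_x (1 + a * (x - b) ^+ 2)^-1%:E = (pi / Num.sqrt a)%:E)%E.
Proof.
move=> a0; pose s : R := Num.sqrt a; have s0 : 0 < s by rewrite sqrtr_gt0.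
pose F : R -> R := fun x => s * (x - b).
have dF (x : R) : is_derive x (1 : R) F s.
  by rewrite /F; apply: is_derive_eq; rewrite /GRing.scale/=; ring.
have F'E : derive1 F = cst s by apply/funext => x; rewrite derive1E derive_val.
have denE x : 1 + a * (x - b) ^+ 2 = oneDsqr (F x).
  by rewrite /oneDsqr /F exprMn sqr_sqrtr// ltW.
have cG := @continuous_cauchy a b a0.
have Fy : F x @[x --> +oo] --> +oo.
  apply/cvgryPge => A; near=> x.
  rewrite /F -ler_pdivrMl// lerBrDr; near: x.
  by apply: nbhs_pinfty_ge; rewrite num_real.
have FNy : F x @[x --> -oo] --> -oo.
  apply/cvgrNyPle => A; near=> x.
  rewrite /F -ler_pdivlMl// lerBlDr; near: x.
  by apply: nbhs_ninfty_le; rewrite num_real.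
have := integralT_oneDsqrV.
rewrite (@increasing_ge0_integration_by_substitutionT _ F)//; first last.
- exact: continuous_oneDsqrV.
- by rewrite F'E; exact: is_cvg_cst.
- by rewrite F'E; exact: is_cvg_cst.
- by rewrite F'E => x; exact: cst_continuous.
- by move=> x y xy; rewrite /F ltr_pM2l// ltrD2r.
rewrite F'E => h.
have : (s%:E * \int[mu]_x (1 + a * (x - b) ^+ 2)^-1%:E = pi%:E)%E.
  rewrite -h -ge0_integralZl//=; last 3 first.
  - by apply/measurable_EFinP; exact: continuous_measurable_fun.
  - by move=> x _; rewrite lee_fin denE invr_ge0.
  - by rewrite lee_fin ltW.
  by apply: eq_integral => x _; rewrite -EFinM mulrC denE.
move=> /(congr1 (fun x => (s^-1)%:E * x)%E).
by rewrite muleA -!EFinM mulVf ?gt_eqF// mul1e mulrC.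
Unshelve. all: by end_near. Qed.

(** Tonelli's theorem, one coordinate at a time. *)
Lemma integral_cV_prod n (f : 'I_n -> R -> R) (c : 'I_n -> R) :
  (forall j, measurable_fun setT (f j)) -> (forall j x, 0 <= f j x) ->
  (forall j, \int[mu]_x (f j x)%:E = (c j)%:E)%E ->
  (\int[lebesgue_cV R n]_v (\prod_j f j (v j 0))%:E = (\prod_j c j)%:E)%E.
Proof.
elim: n f c => [|n IH] f c mf f0 fc.
  rewrite /= integral_dirac//.
    by rewrite diracT mul1e !big_ord0.
  by apply/measurable_EFinP; apply: measurable_prod => i; case: (i).
have mprod m (g : 'I_m -> R -> R) : (forall j, measurable_fun setT (g j)) ->
    measurable_fun [set: 'cV[R]_m] (fun v => (\prod_j g j (v j 0))%:E).
  move=> mg; apply/measurable_EFinP; apply: measurable_prod => j _.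
  exact: (measurableT_comp (mg j) (measurable_coord j 0)).
rewrite (_ : (\int[_]_v _)%E = (\int[(mu \x lebesgue_cV R n)%E]_p
    (f ord0 p.1 * \prod_j f (lift ord0 j) (p.2 j 0))%:E)%E); last first.
  rewrite [LHS](ge0_integral_pushforward (@measurable_cons_cV R n))//; last 2 first.
  - exact: mprod.
  - by move=> v _; rewrite lee_fin prodr_ge0.
  rewrite preimage_setT; apply: eq_integral => p _ /=.
  rewrite big_ord_recl cons_cV0; congr (_ * _)%:E.
  by apply: eq_bigr => j _; rewrite cons_cVS.
rewrite fubini_tonelli1/=; last 2 first.
- apply/measurable_EFinP; apply: measurable_funM.
    exact: (measurableT_comp (mf ord0) measurable_fst).
  apply: measurable_prod => j _; apply: (measurableT_comp (mf (lift ord0 j))).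
  exact: (measurableT_comp (measurable_coord j 0) measurable_snd).
- by move=> p; rewrite lee_fin mulr_ge0 ?prodr_ge0.
rewrite /fubini_F /= big_ord_recl.
under eq_integral => x _.
  under eq_integral do rewrite EFinM.
  rewrite ge0_integralZl//=; last 3 first.
  - exact: (mprod n (fun j => f (lift ord0 j))).
  - by move=> v _; rewrite lee_fin prodr_ge0.
  - by rewrite lee_fin.
  rewrite (IH (fun j => f (lift ord0 j)) (fun j => c (lift ord0 j)))// muleC; over.
rewrite /= ge0_integralZl//=.
- by rewrite fc -EFinM mulrC.
- have h := (measurable_EFinP _ _).2 (mf ord0); exact h.
- by move=> x _; rewrite lee_fin.
- rewrite lee_fin prodr_ge0// => j _.
  by rewrite -lee_fin -fc integral_ge0// => x _; rewrite lee_fin.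
Qed.

Lemma measurable_dotv n (w : 'cV[R]_n) :
  measurable_fun setT (fun u : 'cV[R]_n => dotv u w).
Proof.
rewrite (_ : (fun u => _) = fun u : 'cV[R]_n => \sum_i u i 0 * w i 0); last first.
  by apply/funext => u; rewrite dotvE.
apply: measurable_sum => i; apply: measurable_funM => //.
exact: measurable_coord.
Qed.

Lemma measurable_sigmoid_product d n (W : nat -> 'cV[R]_d) :
  measurable_fun setT (sigmoid_product n W).
Proof.
apply: measurable_prod => i _; apply: measurableT_comp (measurable_dotv _).
apply: continuous_measurable_fun; exact: continuous_sigmoid.
Qed.

Lemma lebesgue_cVT_gt0 d : (0 < lebesgue_cV R d setT)%E.
Proof.
apply: (@lt_le_trans _ _ (lebesgue_cV R d [set v | forall i, `[0, 1]%classic (v i 0)])).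
  rewrite (lebesgue_cV_box (fun=> measurable_itv _)).
  by rewrite big1// => i _; rewrite lebesgue_measure_itv/= lte01 sube0.
apply: le_measure; rewrite ?inE//.
rewrite [X in measurable X](_ : _ =
    \bigcap_(i in [set: 'I_d]) [set v : 'cV[R]_d | `[0, 1]%classic (v i 0)]).
  apply: fin_bigcap_measurable => // i _.
  rewrite -[X in measurable X]setTI.
  by apply: measurable_coord => //; exact: measurable_itv.
by apply/seteqP; split=> v /= h i; [move=> _; exact: h|exact: h].
Qed.

Lemma integral_cV_gt0 d (f : 'cV[R]_d -> R) :
  measurable_fun setT f -> (forall v, 0 < f v) ->
  (0 < \int[lebesgue_cV R d]_v (f v)%:E)%E.
Proof.
move=> mf f0; rewrite lt0e integral_ge0 ?andbT => [|v _]; last by rewrite lee_fin ltW.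
apply/negP => /eqP int0.
have [ae0 _] := @ae_eq_integral_abs _ _ _ (lebesgue_cV R d) setT measurableT
  (EFin \o f) ((measurable_EFinP _ _).2 mf).
have {ae0} [|N [mN N0 fN]] := ae0.
  by rewrite -[RHS]int0; apply: eq_integral => v _ /=; rewrite ger0_norm// ltW.
have := lebesgue_cVT_gt0 d; rewrite (_ : setT = N) ?N0 ?ltxx//.
apply/seteqP; split => // v _; apply: fN => /= /(_ Logic.I) /eqP.
by rewrite eqe gt_eqF.
Qed.

End integrals.

(** The acceptance probability integrates a function of an arbitrary mean [mu];
    the integral of a nonnegative function is a supremum over the simple
    functions below it, and as such is monotone without measurability. *)
Lemma ge0_le_integral_nonmeasurable d (T : measurableType d) (R : realType)
  (mu : {measure set T -> \bar R}) (f g : T -> \bar R) :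
  (forall x, 0 <= f x)%E -> (forall x, f x <= g x)%E ->
  (\int[mu]_x f x <= \int[mu]_x g x)%E.
Proof.
move=> f0 fg.
have g0 x : (0 <= g x)%E := le_trans (f0 x) (fg x).
rewrite !ge0_integralTE//; apply: le_ereal_sup => _ [h hf <-].
by exists h => // x; exact: le_trans (hf x) (fg x).
Qed.

(** * Rare events in an independent and identically distributed sequence *)

Section iid_theory.
Context {d1 d2 : measure_display} {Omega : measurableType d1}
  {T : measurableType d2} {R : realType}.
Variables (P : probability Omega R).

Lemma iid_comp d3 (T' : measurableType d3) (Z : nat -> Omega -> T) (g : T -> T') :
  measurable_fun setT g -> iid P Z -> iid P (fun i w => g (Z i w)).
Proof.
move=> mg [indep idd]; split.
- move=> s B us mB.
  apply: (indep s (fun i => g @^-1` B i) us) => i.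
  by rewrite -[X in measurable X]setTI; apply: mg.
- move=> i j B mB; apply: (idd i j (g @^-1` B)).
  by rewrite -[X in measurable X]setTI; apply: mg.
Qed.

Lemma measure_bigsetU_le (I : Type) (s : seq I) (p : pred I) (F : I -> set Omega) :
  (forall i, p i -> measurable (F i)) ->
  (P (\big[setU/set0]_(i <- s | p i) F i) <= \sum_(i <- s | p i) P (F i))%E.
Proof.
move=> mF; elim: s => [|i s IH]; first by rewrite !big_nil measure0.
rewrite !big_cons; case: ifP => // pi.
apply: (le_trans (measureU2 _ _ _)) => //; [exact: mF|exact: bigsetU_measurable|].
exact: leeD2l.
Qed.

Lemma borel_cantelli (F : (set Omega)^nat) :
  (forall n, measurable (F n)) -> (\sum_(n <oo) P (F n) < +oo)%E ->
  {ae P, forall w, \forall n \near \oo, ~ F n w}.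
Proof.
move=> mF sumF; exists (lim_sup_set F); split.
- by apply: bigcapT_measurable => n; apply: bigcup_measurable => k _.
- exact: lim_sup_set_cvg0.
move=> w /= nF n _; apply: contrapT => hn; apply: nF.
exists n => // k /= nk Fk; apply: hn; by exists k.
Qed.

Variable Z : nat -> Omega -> T.
Hypothesis mZ : forall i, measurable_fun setT (Z i).
Hypothesis Ziid : iid P Z.

Let mpre i B : measurable B -> measurable (Z i @^-1` B).
Proof. by move=> mB; rewrite -[X in measurable X]setTI; apply: mZ. Qed.

Lemma iid_ae (B : set T) : measurable B ->
  {ae P, forall w, B (Z 0%N w)} -> {ae P, forall w i, B (Z i w)}.
Proof.
move=> mB B0; apply: ae_foralln => i.
have mC : measurable (~` B) by exact: measurableC.
have : P (Z 0%N @^-1` (~` B)) = 0%E by apply/negligibleP => //; exact: mpre.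
rewrite (Ziid.2 0%N i _ mC) => Pi.
exists (Z i @^-1` (~` B)); split => //; exact: mpre.
Qed.

(** At least half of the first [n] terms lie in [B] only if all the terms of
    some index set [S] with [n <= 2 |S|] do; each such [S] has probability at most
    [16 ^ (- |S|) <= 4 ^ (- n)], and there are at most [2 ^ n] of them.  The sum of
    the bounds [2 ^ (- n)] is finite. *)
Lemma iid_rarely_in (B : set T) : measurable B ->
  (P (Z 0%N @^-1` B) <= (1 / 16)%:E)%E ->
  {ae P, forall w, \forall n \near \oo,
    (2 * #|[pred i : 'I_n | `[< B (Z i w) >]]| < n)%N}.
Proof.
move=> mB PB.
pose F n := \big[setU/set0]_(S : {set 'I_n} | (n <= 2 * #|S|)%N)
  \bigcap_(i in [set` [seq val i | i <- enum S]]) (Z i @^-1` B).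
have mI n (S : {set 'I_n}) :
    measurable (\bigcap_(i in [set` [seq val i | i <- enum S]]) (Z i @^-1` B)).
  apply: fin_bigcap_measurable => [|i _]; [exact: finite_seq|exact: mpre].
have mF n : measurable (F n) by apply: bigsetU_measurable => S _.
have PF n : (P (F n) <= ((1 / 2) ^+ n)%:E)%E.
  have PS (S : {set 'I_n}) : (n <= 2 * #|S|)%N ->
      (P (\bigcap_(i in [set` [seq val i | i <- enum S]]) (Z i @^-1` B)) <=
       ((1 / 4) ^+ n)%:E)%E.
    move=> nS; rewrite Ziid.1//; last first.
      by rewrite map_inj_uniq ?enum_uniq//; exact: val_inj.
    have [p Pp] : exists p : R, P (Z 0%N @^-1` B) = p%:E.
      exists (fine (P (Z 0%N @^-1` B))); rewrite fineK// fin_num_measure//.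
      exact: mpre.
    rewrite big_map (eq_bigr (fun=> p%:E)) => [|i _]; last by rewrite (Ziid.2 _ 0%N).
    rewrite prodEFin big_enum prodr_const lee_fin.
    have p0 : 0 <= p by rewrite -lee_fin -Pp.
    have p16 : p <= (1 / 4) ^+ 2 by move: PB; rewrite Pp lee_fin; lra.
    apply: (@le_trans _ _ (((1 / 4) ^+ 2) ^+ #|S|)).
      by rewrite lerXn2r ?nnegrE//; lra.
    by rewrite -exprM ler_wiXn2l//; lra.
  apply: le_trans (measure_bigsetU_le _ _) _ => //.
  apply: (@le_trans _ _ (\sum_(S : {set 'I_n}) ((1 / 4) ^+ n : R)%:E)%E).
    rewrite big_mkcond; apply: lee_sum => S _; case: ifPn => [/PS//|_].
    by rewrite lee_fin exprn_ge0.
  rewrite sumEFin lee_fin sumr_const -cardsT -powersetT card_powerset cardsT.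
  rewrite card_ord -[_ *+ (2 ^ n)%N]mulr_natr natrX -exprMn.
  by rewrite (_ : 1 / 4 * 2 = 1 / 2)//; lra.
have : {ae P, forall w, \forall n \near \oo, ~ F n w}.
  apply: borel_cantelli => //.
  apply: (@le_lt_trans _ _ (\sum_(n <oo) ((1 / 2) ^+ n : R)%:E)%E).
    by apply: lee_nneseries => // n _; exact: measure_ge0.
  rewrite (eq_eseriesr (g := fun n => (2 / (2 ^ (n + 1))%:R)%:E)) => [|n _].
    by rewrite (cvg_lim _ (@cvg_geometric_eseries_half R 2 0))// ltry.
  by congr EFin; rewrite natrX exprD expr1 expr_div_n expr1n; field; rewrite expf_neq0.
apply: filterS => w; apply: filterS => n nF.
rewrite ltnNge; apply/negP => hn; apply: nF.
rewrite /F -bigcup_seq_cond.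
exists (finset [pred i : 'I_n | `[< B (Z i w) >]]) => /=.
  by rewrite mem_index_enum cardsE.
by move=> _ /mapP[i + ->]; rewrite mem_enum inE => /asboolP.
Qed.

(** Continuity from above of [P] along the events [`|f| < (k + 1)^-1], whose
    intersection is negligible. *)
Lemma small_ball_probability (f : Omega -> R) (eta : R) : measurable_fun setT f ->
  {ae P, forall w, f w != 0} -> 0 < eta ->
  exists2 eps, 0 < eps <= 1 & (P [set w | (`|f w| < eps)%R] <= eta%:E)%E.
Proof.
move=> mf f0 eta0; apply: contrapT => h.
pose F (k : nat) := [set w | `|f w| < k.+1%:R^-1].
have mF k : measurable (F k).
  rewrite -[X in measurable X]setTI.
  apply: (measurable_fun_ltr (f := fun w => `|f w|) (g := cst _) _ _ measurableT
    (Y := [set true])) => //.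
  exact: measurableT_comp.
have F0 : \bigcap_n F n = [set w | f w = 0].
  apply/seteqP; split => w /= hw; last by move=> k _; rewrite /F/= hw normr0.
  apply/eqP; rewrite -normr_le0 leNgt; apply/negP => fw0.
  have := hw (Num.truncn (`|f w|^-1)) Logic.I; rewrite /F/=.
  by rewrite ltNge -[leRHS]invrK lef_pV2 ?posrE ?invr_gt0// ltW// truncnS_gt.
have mF0 : measurable (\bigcap_n F n) by exact: bigcapT_measurable.
have PF0 : P (\bigcap_n F n) = 0%E.
  apply/negligibleP => //; rewrite F0; apply: negligibleS f0 => w /= ->.
  by rewrite eqxx.
have : P \o F @ \oo --> P (\bigcap_n F n).
  apply: nonincreasing_cvg_mu => //.
    by rewrite (le_lt_trans (probability_le1 _ _))// ltry.
  move=> m n mn; apply/subsetPset => w /= /lt_le_trans; apply.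
  by rewrite lef_pV2 ?posrE// ler_nat.
rewrite PF0 => PFcvg; suff : (eta%:E <= (0 : \bar R))%E by rewrite lee_fin leNgt eta0.
apply: cvge_ge PFcvg; apply: nearW => k /=.
rewrite leNgt; apply/negP => /ltW Pk; apply: h.
by exists k.+1%:R^-1 => //; rewrite invr_gt0 ltr0n/= invf_le1// ler1n.
Qed.

End iid_theory.

(** * Spread of the covariates in all directions *)

Section spread.
Context {disp : measure_display} {Omega : measurableType disp} {R : realType}.
Variables (P : probability Omega R) (d : nat) (X : nat -> Omega -> 'cV[R]_d).
Hypothesis d_gt0 : (0 < d)%N.
Hypothesis mX : forall i, measurable_fun setT (X i).
Hypothesis X_iid : iid P X.

Lemma measurable_norm_le (r : R) : 0 <= r -> measurable [set x : 'cV[R]_d | `|x| <= r].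
Proof.
move=> r0; rewrite (_ : mkset _ =
    \bigcap_(i in [set: 'I_d]) [set x : 'cV[R]_d | `|x i 0| <= r]).
  apply: fin_bigcap_measurable => // i _.
  rewrite (_ : mkset _ = (fun x : 'cV[R]_d => x i 0) @^-1` `[- r, r]); last first.
    by apply/seteqP; split => x /=; rewrite in_itv/= ler_norml.
  rewrite -[X in measurable X]setTI.
  by apply: measurable_coord => //; exact: measurable_itv.
apply/seteqP; split => x /= h.
  by move=> i _ /=; apply: le_trans h; exact: coord_le_norm.
by apply: norm_le_coord => // i; exact: (h i Logic.I).
Qed.

Lemma eventually_half_spread_along (u : 'cV[R]_d) :
  {ae P, forall w, dotv u (X 0%N w) != 0} ->
  exists2 eps : R, 0 < eps <= 1 &
  {ae P, forall w, \forall n \near \oo,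
    (2 * #|[pred i : 'I_n | (`|dotv u (X i w)| < eps)%R]| < n)%N}.
Proof.
move=> u0.
have mdot : measurable_fun setT (fun x : 'cV[R]_d => dotv u x).
  by under eq_fun do rewrite dotvC; exact: measurable_dotv.
have [eps eps01 Peps] := small_ball_probability (measurableT_comp mdot (mX 0%N)) u0
   (divr_gt0 ltr01 (ltr0n R 16)).
exists eps => //.
pose B := [set x : 'cV[R]_d | `|dotv u x| < eps].
have mB : measurable B.
  rewrite -[X in measurable X]setTI.
  apply: (measurable_fun_ltr (f := fun x => `|dotv u x|) (g := cst _) _ _
    measurableT (Y := [set true])) => //.
  exact: measurableT_comp.
have := iid_rarely_in mX X_iid mB Peps.
apply: filterS => w; apply: filterS => n; congr (2 * _ < _)%N.
by apply: eq_card => i; rewrite !inE asboolb.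
Qed.

(** The width [e v] of the exceptional slab depends on the direction [v]; the
    balls of radius [e v / (2 d)] cover the unit sphere, and within such a ball a
    covariate of norm at most 1 changes its scalar product by at most [e v / 2].
    A finite subcover leaves finitely many almost sure events. *)
Lemma eventually_half_spread :
  {ae P, forall w, `|X 0%N w| <= 1} ->
  (forall u : 'cV[R]_d, u != 0 -> {ae P, forall w, dotv u (X 0%N w) != 0}) ->
  exists2 eps : R, 0 < eps <= 1 &
  {ae P, forall w, \forall n \near \oo, forall u : 'cV[R]_d,
    (n <= 2 * #|[pred i : 'I_n | (eps * `|u| <= `|dotv u (X i w)|)%R]|)%N}.
Proof.
move=> X1 X0.
have dR : 0 < d%:R :> R by rewrite ltr0n.
have /choice[e he] : forall u : 'cV[R]_d, exists e : R, 0 < e <= 1 /\ (u != 0 ->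
    {ae P, forall w, \forall n \near \oo,
    (2 * #|[pred i : 'I_n | (`|dotv u (X i w)| < e)%R]| < n)%N}).
  move=> u; have [->|u0] := eqVneq u 0.
    by exists 1; split; [rewrite ltr01 lexx|].
  have [eps eps01 heps] := eventually_half_spread_along (X0 u u0).
  by exists eps.
have e0 u : 0 < e u by case: (he u) => /andP[].
have e1 u : e u <= 1 by case: (he u) => /andP[].
pose S := [set v : 'cV[R]_d | `|v| = 1].
have compactS : compact S.
  apply: (@compact_cV _ _ _ 1) => [|u ->//].
  apply: ((continuous_closedP (fun u : 'cV[R]_d => `|u|)).1
    (@norm_continuous R 'cV[R]_d) [set x | x = 1]).
  exact: closed_eq.
have := compactS; rewrite compact_cover.
move=> /(_ _ setT (fun v => ball v (e v / (2 * d%:R)))) [].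
- move=> v _; apply: ball_open; by rewrite divr_gt0// mulr_gt0.
- by move=> v Sv; exists v => //; apply: ballxx; rewrite divr_gt0// mulr_gt0.
move=> D _ coverD.
(* a positive number below all the [e v / 2], since these are at most 1 *)
pose eps := \prod_(v <- D) (e v / 2).
have eps0 : 0 < eps by apply: prodr_gt0 => v _; rewrite divr_gt0.
have e2 v : 0 <= e v / 2 <= 1 by apply/andP; split; have := e0 v; have := e1 v; lra.
have epsD v : v \in D -> eps <= e v / 2.
  move=> vD; rewrite /eps (big_rem v)//= ler_piMr//; first by case/andP: (e2 v).
  by rewrite prodr_ile1.
have eps1 : eps <= 1 by rewrite prodr_ile1.
exists eps; first by rewrite eps0.
have bnd := iid_ae mX X_iid (measurable_norm_le ler01) X1.
have netD : {ae P, forall w, \forall n \near \oo, forall v, v \in D -> v != 0 ->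
    (2 * #|[pred i : 'I_n | (`|dotv v (X i w)| < e v)%R]| < n)%N}.
  have : {ae P, forall w, (\bigcap_(v in [set` D]) [set w | v != 0 -> \forall n \near \oo,
      (2 * #|[pred i : 'I_n | (`|dotv v (X i w)| < e v)%R]| < n)%N]) w}.
    apply: filter_bigI => v vD; have [->|v0] := eqVneq v 0; first by apply: aeW.
    by have := (he v).2 v0; apply: filterS => w /=.
  apply: filterS => w hw.
  have : \forall n \near \oo, (\bigcap_(v in [set` D]) [set n | v != 0 ->
      (2 * #|[pred i : 'I_n | (`|dotv v (X i w)| < e v)%R]| < n)%N]) n.
    apply: filter_bigI => v vD; have [->|v0] := eqVneq v 0.
      by exists 0%N => // n _ /=; rewrite eqxx.
    by have [N _ hN] := hw v vD v0; exists N => // n Nn _; exact: hN.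
  by apply: filterS => n h v vD; exact: h.
apply: filterS2 bnd netD => w bnd; apply: filterS => n netD u.
have [->|u0] := eqVneq u 0.
  rewrite (eq_card (B := predT)) => [|i]; last first.
    by rewrite !inE /= normr0 mulr0 normr_ge0.
  by rewrite card_ord leq_pmull.
have nu0 : 0 < `|u| by rewrite normr_gt0.
pose v := `|u|^-1 *: u.
have Sv : S v by rewrite /S /= normrZ ger0_norm ?invr_ge0// mulVf// gt_eqF.
have [v0 v0D vv0] := coverD v Sv.
have v0_neq0 : v0 != 0.
  apply/eqP => v00; move: vv0; rewrite v00 mx_norm_ball /ball_/= sub0r normrN Sv.
  rewrite ltNge => /negP; apply; rewrite ler_pdivrMr ?mulr_gt0// mul1r.
  rewrite (le_trans (e1 _))//; have : 1 <= d%:R :> R by rewrite ler1n.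
  lra.
pose A := [pred i : 'I_n | `|dotv v0 (X i w)| < e v0].
have few : (2 * #|A| < n)%N := netD v0 v0D v0_neq0.
have total : (#|A| + #|predC A| = n)%N by rewrite cardC card_ord.
suff : (#|predC A| <= #|[pred i : 'I_n | (eps * `|u| <= `|dotv u (X i w)|)%R]|)%N.
  by move: (#|A|) (#|predC A|) (#|_|) few total; lia.
apply: subset_leq_card; apply/fintype.subsetP => i; rewrite !inE -leNgt => v0X.
rewrite (_ : u = `|u| *: v); last by rewrite scalerA divff ?scale1r// gt_eqF.
rewrite normrZ normr_id (Sv : `|v| = 1) mulr1 dotvZl normrM normr_id mulrC ler_pM2l//.
apply: (le_trans (epsD _ v0D)).
have dv : `|dotv (v0 - v) (X i w)| <= e v0 / 2.
  apply: (le_trans (dotv_le _ _)).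
  apply: (@le_trans _ _ (d%:R * (e v0 / (2 * d%:R)) * 1)).
    rewrite ler_pM ?mulr_ge0//; last exact: bnd.
    rewrite ler_pM2l//; move: vv0; rewrite mx_norm_ball; exact: ltW.
  by rewrite mulr1 le_eqVlt; apply/orP; left; apply/eqP; field; rewrite gt_eqF.
have : dotv v0 (X i w) = dotv (v0 - v) (X i w) + dotv v (X i w) by rewrite -dotvDl subrK.
move=> h; move: v0X; rewrite h => v0X.
have := ler_normD (dotv (v0 - v) (X i w)) (dotv v (X i w)); lra.
Qed.

End spread.

(** * The acceptance probability *)

Section metropolis_hastings_bound.
Context {R : realType} {d : nat}.

Lemma quad_form_invmx_ge0 (S : 'M[R]_d) (x : 'cV[R]_d) :
  (forall u : 'cV[R]_d, u != 0 -> 0 < (u^T *m S *m u) 0 0) ->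
  0 <= (x^T *m invmx S *m x) 0 0.
Proof.
move=> Spos; have Sge0 (u : 'cV[R]_d) : 0 <= (u^T *m S *m u) 0 0.
  have [->|u0] := eqVneq u 0; first by rewrite mulmx0 mxE.
  by rewrite ltW// Spos.
have [uS|nuS] := boolP (S \in unitmx); last first.
  (* [invmx] is the identity on singular matrices *)
  by rewrite /invmx (negbTE nuS).
(* with v = S^-1 x, the form is x^T v = (v^T S v)^T, a scalar *)
have := Sge0 (invmx S *m x); rewrite -mulmxA mulKVmx//.
by rewrite -/(dotv _ _) dotvC /dotv mulmxA.
Qed.

Lemma gaussian_density_le (m x : 'cV[R]_d) (S : 'M[R]_d) :
  (forall u : 'cV[R]_d, u != 0 -> 0 < (u^T *m S *m u) 0 0) ->
  0 <= gaussian_density m S x <= (Num.sqrt ((2 * pi) ^+ d * \det S))^-1.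
Proof.
move=> Spos; rewrite /gaussian_density mulr_ge0 ?expR_ge0 ?invr_ge0//=.
rewrite ler_piMl ?invr_ge0// expR_le1.
by rewrite mulNr oppr_le0 divr_ge0// quad_form_invmx_ge0.
Qed.

(** The factor [q t t'] cancels the denominator of the acceptance ratio, which
    leaves the density [q t' t] of the reverse move. *)
Lemma mh_accept_le (p : 'cV[R]_d -> R) (q : 'cV[R]_d -> 'cV[R]_d -> R) (D : R) t t' :
  0 < p t -> 0 <= p t' -> (forall s s', 0 <= q s s' <= D) ->
  0 <= mh_accept p q t t' * q t t' <= p t' / p t * D.
Proof.
move=> pt0 pt'0 qD.
have [q0 _] := andP (qD t t'); have [q'0 q'D] := andP (qD t' t).
rewrite /mh_accept; case: ifPn => [pq0|].
  have qt0 : 0 < q t t' by move: pq0; rewrite pmulr_rgt0.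
  apply/andP; split.
    by rewrite mulr_ge0// le_min ler01 andbT divr_ge0 ?mulr_ge0// ltW.
  apply: (@le_trans _ _ (p t' * q t' t / (p t * q t t') * q t t')).
    by rewrite ler_pM2r// ge_min lexx.
  rewrite (_ : _ * q t t' = p t' / p t * q t' t); last first.
    by field; rewrite !gt_eqF.
  by rewrite ler_wpM2l// divr_ge0// ltW.
rewrite pmulr_rgt0// -leNgt => qt0.
have -> : q t t' = 0 by apply/eqP; rewrite eq_le qt0 q0.
rewrite mulr0 lexx/=; apply: mulr_ge0; last exact: le_trans q'0 q'D.
by rewrite divr_ge0// ltW.
Qed.

(** The domination hypothesis is used twice: it bounds the acceptance
    integral, and it shows that the likelihood has a finite integral, without
    which [posterior] would vanish and every proposal be accepted. *)
Lemma mh_acceptance_probability_le (n : nat) (Y : nat -> bool) (X : nat -> 'cV[R]_d)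
  (q : 'cV[R]_d -> 'cV[R]_d -> R) (beta : 'cV[R]_d) (K D : R) :
  (0 < n)%N -> 0 <= K -> 0 <= D -> (forall s s', 0 <= q s s' <= D) ->
  (forall u, likelihood n Y X (beta + u) <= likelihood n Y X beta *
    \prod_(j < d) (K / (1 + n%:R * u j 0 ^+ 2))) ->
  (mh_acceptance_probability (posterior n Y X) q beta <=
   ((K * pi / Num.sqrt n%:R) ^+ d * D)%:E)%E.
Proof.
move=> n0 K0 D0 qD Ldec.
have nR : 0 < n%:R :> R by rewrite ltr0n.
pose L := likelihood n Y X.
have L0 b : 0 < L b by rewrite /L likelihoodE; exact: sigmoid_product_gt0.
have mL : measurable_fun setT L.
  by rewrite /L likelihoodE; exact: measurable_sigmoid_product.
pose f (j : 'I_d) (x : R) := K / (1 + n%:R * (x - beta j 0) ^+ 2).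
have mden (b : R) : measurable_fun setT (fun x : R => (1 + n%:R * (x - b) ^+ 2)^-1).
  by apply: continuous_measurable_fun; exact: continuous_cauchy.
have f0 j x : 0 <= f j x.
  by rewrite divr_ge0// addr_ge0// mulr_ge0// sqr_ge0.
have mf j : measurable_fun setT (f j) by apply: measurable_funM.
have intf j : (\int[lebesgue_measure]_x (f j x)%:E = (K * pi / Num.sqrt n%:R)%:E)%E.
  under eq_integral do rewrite EFinM.
  rewrite ge0_integralZl//=.
  - by rewrite integralT_cauchy// -EFinM mulrA.
  - have h := (measurable_EFinP _ _).2 (mden (beta j 0)); exact h.
  - by move=> x _; rewrite lee_fin invr_ge0 addr_ge0// mulr_ge0// sqr_ge0.
have mprodf : measurable_fun setT (fun b : 'cV[R]_d => \prod_j f j (b j 0)).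
  apply: measurable_prod => j _.
  exact: (measurableT_comp (mf j) (measurable_coord j 0)).
have intprod : (\int[lebesgue_cV R d]_b (\prod_j f j (b j 0))%:E =
    ((K * pi / Num.sqrt n%:R) ^+ d)%:E)%E.
  rewrite (integral_cV_prod mf f0 intf) prodr_const card_ord//.
have Lle b : L b <= L beta * \prod_j f j (b j 0).
  have -> : \prod_j f j (b j 0) =
      \prod_(j < d) (K / (1 + n%:R * (b - beta) j 0 ^+ 2)).
    by apply: eq_bigr => j _; rewrite !mxE.
  by have := Ldec (b - beta); rewrite addrC subrK.
have intL_lty : (\int[lebesgue_cV R d]_b (L b)%:E < +oo)%E.
  apply: (@le_lt_trans _ _
    (\int[lebesgue_cV R d]_b ((L beta)%:E * (\prod_j f j (b j 0))%:E))%E).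
    apply: ge0_le_integral_nonmeasurable => b; first by rewrite lee_fin ltW.
    by rewrite -EFinM lee_fin.
  rewrite ge0_integralZl//=.
  - by rewrite intprod -EFinM ltry.
  - exact/measurable_EFinP.
  - by move=> b _; rewrite lee_fin prodr_ge0.
  - by rewrite lee_fin ltW.
have intL_gt0 := integral_cV_gt0 mL L0.
pose Z := fine (\int[lebesgue_cV R d]_b (L b)%:E)%E.
have Z0 : 0 < Z by rewrite fine_gt0// intL_gt0.
have post0 b : 0 < posterior n Y X b by rewrite divr_gt0// L0.
have acc t' := mh_accept_le (post0 beta) (ltW (post0 t')) qD.
rewrite /mh_acceptance_probability.
apply: (@le_trans _ _ (\int[lebesgue_cV R d]_b (D%:E * (\prod_j f j (b j 0))%:E))%E).
  apply: ge0_le_integral_nonmeasurable => b.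
    by rewrite lee_fin; case/andP: (acc b).
  rewrite -EFinM lee_fin; case/andP: (acc b) => _ /le_trans; apply.
  rewrite mulrC ler_wpM2l// ler_pdivrMr//.
  rewrite /posterior -/L -/Z mulrA ler_pM2r ?invr_gt0// mulrC; exact: Lle.
rewrite ge0_integralZl//=.
- by rewrite intprod -EFinM mulrC.
- exact/measurable_EFinP.
- by move=> b _; rewrite lee_fin prodr_ge0.
Qed.

Lemma norm_le_norm2 (x : 'cV[R]_d) : `|x| <= norm2 x.
Proof.
apply: norm_le_coord => [|i]; first exact: sqrtr_ge0.
rewrite -sqrtr_sqr ler_wsqrtr// (bigD1 i)//= lerDl sumr_ge0// => j _.
exact: sqr_ge0.
Qed.

End metropolis_hastings_bound.

(** The normalization [((2 pi h)^d det C)^(-1/2)] supplies the power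
    [h ^ (- d/2)]; what is left over, [(2 pi) ^ (- d/2) <= 1], is discarded. *)
Lemma gaussian_constant_le (R : realType) (d : nat) (C : 'M[R]_d) (h N K : R) :
  0 < h -> 0 < N -> 0 <= K ->
  (K / Num.sqrt N) ^+ d * (Num.sqrt ((2 * pi) ^+ d * \det (h *: C)))^-1 <=
  (K ^+ 2 / (N * h)) `^ (d%:R / 2) * (2 / Num.sqrt (\det C)).
Proof.
move=> h0 N0 K0.
have -> : (K ^+ 2 / (N * h)) `^ (d%:R / 2) = (K / Num.sqrt (N * h)) ^+ d.
  rewrite (_ : K ^+ 2 / (N * h) = (K / Num.sqrt (N * h)) `^ 2%:R); last first.
    rewrite powR_mulrn ?divr_ge0 ?sqrtr_ge0// expr_div_n sqr_sqrtr//.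
    by rewrite mulr_ge0// ltW.
  rewrite -powRrM (_ : 2%:R * (d%:R / 2) = d%:R); last by field.
  by rewrite powR_mulrn// divr_ge0 ?sqrtr_ge0.
rewrite detZ mulrA -exprMn sqrtrM; last first.
  by rewrite exprn_ge0// !mulr_ge0 ?pi_ge0// ltW.
have p1 : 1 <= 2 * pi :> R by have := pi_ge2 R; lra.
have sh : Num.sqrt h ^+ d <= Num.sqrt ((2 * pi * h) ^+ d).
  rewrite -[leLHS]ger0_norm ?exprn_ge0// -sqrtr_sqr ler_wsqrtr//.
  rewrite -exprM mulnC exprM sqr_sqrtr ?(ltW h0)//.
  rewrite lerXn2r ?nnegrE ?mulr_ge0 ?pi_ge0 ?(ltW h0)//.
  by rewrite ler_peMl// ltW.
have s0 : 0 < Num.sqrt h ^+ d by rewrite exprn_gt0// sqrtr_gt0.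
rewrite [Num.sqrt (N * h)]sqrtrM ?(ltW N0)// !invfM [K * (_ * _)]mulrA.
rewrite [in leRHS]exprMn [(Num.sqrt h)^-1 ^+ d]exprVn.
rewrite -[leRHS]mulrA ler_wpM2l ?exprn_ge0 ?divr_ge0//.
rewrite mulrA ler_wpM2r ?invr_ge0//.
apply: (@le_trans _ _ (Num.sqrt h ^+ d)^-1).
  by rewrite lef_pV2 ?posrE// (lt_le_trans s0).
by rewrite ler_peMr ?invr_ge0 ?(ltW s0)//; lra.
Qed.

Theorem theorem5 (R : realType) (disp : measure_display)
  (Omega : measurableType disp) (P : probability Omega R)
  (d : nat) (d_gt0 : (0 < d)%N)
  (Y : nat -> {RV P >-> bool}) (X : nat -> {RV P >-> 'cV[R]_d})
  (YX_iid : iid P (fun i w => (Y i w, X i w)))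
  (mu : 'cV[R]_d -> 'cV[R]_d) (h : R) (h_gt0 : 0 < h)
  (C : 'M[R]_d) (C_pd : symm_posdef C)
  (betastar : nat -> Omega -> 'cV[R]_d)
  (betastar_MLE : forall (n : nat) (w : Omega),
    (exists b : 'cV[R]_d, is_MLE n (Y ^~ w) (X ^~ w) b) ->
    is_MLE n (Y ^~ w) (X ^~ w) (betastar n w))
  (assumption1 : {ae P, forall w, \forall n \near \oo,
    \rank (design_mx n (X ^~ w)) = d /\
    exists b : 'cV[R]_n, (forall i : 'I_n, 0 < b i 0) /\
      (signed_design_mx n (Y ^~ w) (X ^~ w))^T *m b = 0})
  (assumption2 : exists beta0 : 'cV[R]_d,
    {ae P, forall w, betastar ^~ w @ \oo --> beta0})
  (assumption3 : {ae P, forall w, norm2 (X 0%N w) <= 1})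
  (assumption4 : forall u : 'cV[R]_d, u != 0 ->
    {ae P, forall w, ((X 0%N w)^T *m u) 0 0 != 0}) :
  exists lambda0 : R, 0 < lambda0 /\
    {ae P, forall w, \forall n \near \oo,
      (mh_acceptance_probability
         (posterior n (Y ^~ w) (X ^~ w))
         (fun theta => gaussian_density (mu theta) (h *: C))
         (betastar n w)
       <= ((lambda0 / (n%:R * h)) `^ (d%:R / 2) *
           (2 / Num.sqrt (\det C)))%:E)%E}.
Proof.
have mX i : measurable_fun setT (X i) by exact: measurable_funPT.
have X_iid : iid P (fun i => X i : Omega -> 'cV[R]_d).
  exact: (iid_comp measurable_snd YX_iid).
have X1 : {ae P, forall w, `|X 0%N w| <= 1}.
  by apply: filterS assumption3 => w; apply: le_trans; exact: norm_le_norm2.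
have X0 (u : 'cV[R]_d) : u != 0 -> {ae P, forall w, dotv u (X 0%N w) != 0}.
  by move=> u0; apply: filterS (assumption4 u u0) => w; rewrite dotvC.
have [eps eps01 spread] := eventually_half_spread d_gt0 mX X_iid X1 X0.
have bounded := iid_ae mX X_iid (measurable_norm_le ler01) X1.
have [beta0 consistent] := assumption2.
(* eventually `|dotv (betastar n w) (X i w)| <= d (`|beta0| + 1), so that both
   sigmoid (dotv _ _) and its complement are bounded away from 0 *)
pose kappa : R := sigmoid (- (d%:R * (`|beta0| + 1))) ^+ 2.
have kappa01 : 0 < kappa <= 1.
  by rewrite exprn_gt0 ?sigmoid_gt0//= exprn_ile1 ?sigmoid_le1 ?ltW ?sigmoid_gt0.
pose K : R := 2 / (kappa * eps ^+ 2 / (32 * d%:R)) ^+ 2.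
have K0 : 0 < K.
  have [[k0 _] [e0 _]] := (andP kappa01, andP eps01).
  by rewrite divr_gt0// exprn_gt0// divr_gt0// mulr_gt0// ?exprn_gt0// ltr0n.
exists ((K * pi) ^+ 2); split; first by rewrite exprn_gt0// mulr_gt0// pi_gt0.
apply: filterS2 (filterI assumption1 consistent) (filterI bounded spread) =>
  w [rankw consw] [bdw spreadw].
have near_beta0 : \forall n \near \oo, `|betastar n w| <= `|beta0| + 1.
  have : \forall n \near \oo, `|beta0 - betastar n w| < 1.
    exact: ((@cvgrPdist_lt R 'cV[R]_d nat \oo _ (betastar ^~ w) beta0).1 consw 1 ltr01).
  apply: filterS => n bn; rewrite -[betastar n w](subKr beta0).
  by rewrite (le_trans (ler_normB _ _))// lerD2l ltW.
have large : \forall n \near \oo, (4 * d <= n)%N by exists (4 * d)%N.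
apply: filterS2 (filterI rankw spreadw) (filterI near_beta0 large) =>
  n [[rk [b [b0 Xb]]] hspread] [hbeta dn].
have n0 : (0 < n)%N by apply: leq_trans dn; rewrite muln_gt0.
have mle : is_MLE n (Y ^~ w) (X ^~ w) (betastar n w).
  by apply: betastar_MLE; exact: sigmoid_product_max rk b0 Xb.
have hC_pos (u : 'cV[R]_d) : u != 0 -> 0 < (u^T *m (h *: C) *m u) 0 0.
  by move=> u0; rewrite -scalemxAr -scalemxAl mxE mulr_gt0//; exact: C_pd.2.
apply: le_trans (mh_acceptance_probability_le (K := K)
  (D := (Num.sqrt ((2 * pi) ^+ d * \det (h *: C)))^-1) n0 _ _ _ _) _.
- exact: ltW.
- by rewrite invr_ge0 sqrtr_ge0.
- by move=> s s'; exact: gaussian_density_le.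
- move=> u; rewrite /is_MLE likelihoodE in mle *.
  apply: sigmoid_productD_decay => //.
    move=> i; have : `|dotv (betastar n w) (signed_cov (Y i w) (X i w))| <=
        d%:R * (`|beta0| + 1).
      rewrite norm_dotv_signed_cov (le_trans (dotv_le _ _))//.
      rewrite -[leRHS]mulr1; apply: ler_pM; [|by []| |exact: bdw].
        exact: mulr_ge0.
      exact: ler_wpM2l.
    rewrite ler_norml => /andP[lo hi].
    by rewrite /kappa expr2 ler_pM ?(ltW (sigmoid_gt0 _))//;
      apply: ler_sigmoid; rewrite ?lerN2.
  rewrite (eq_card (B := [pred i : 'I_n | eps * `|u| <= `|dotv u (X i w)|])) => [|i];
    last first.
    by rewrite !inE norm_dotv_signed_cov.
  exact: hspread.
rewrite lee_fin; apply: gaussian_constant_le => //; first by rewrite ltr0n.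
by rewrite mulr_ge0 ?pi_ge0// ltW.
Qed.
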